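(* Let $X$ be a zero-dimensional space. Then $C_c^K(X)=O_c^{\beta_0X\setminus X}$.
   Context: A zero-dimensional space is a Hausdorff topological space with a base of clopen sets. For such $X$, $C_c(X)$ is the ring (under pointwise operations) of all continuous functions $f:X\to\mathbb{R}$ with countable image; $Z(f)=\{x\in X: f(x)=0\}$. The Banaschewski compactification $\beta_0X$ is the (unique up to homeomorphism) compact zero-dimensional space containing $X$ as a dense subspace such that every continuous function $X\to\{0,1\}$ extends continuously to $\beta_0X$. The support of $f\in C_c(X)$ is $\mathrm{cl}_X(X\setminus Z(f))$, and $C_c^K(X)$ is the set of all $f\in C_c(X)$ with compact support. For $p\in\beta_0X$, $O_c^p=\{f\in C_c(X): p\in \mathrm{int}_{\beta_0X}\mathrm{cl}_{\beta_0X}Z(f)\}$, and for $A\subseteq\beta_0X$, $O_c^A=\bigcap_{p\in A}O_c^p=\{f\in C_c(X): A\subseteq \mathrm{int}_{\beta_0X}\mathrm{cl}_{\beta_0X}Z(f)\}$ (so $O_c^{\emptyset}=C_c(X)$). *)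

(* Defs.v *)
From HB Require Import structures.
From mathcomp Require Import all_boot all_order all_algebra.
From mathcomp Require Import all_classical all_reals all_analysis.

Set Implicit Arguments.
Unset Strict Implicit.
Unset Printing Implicit Defensive.

Import numFieldNormedType.Exports.

Local Open Scope classical_set_scope.
Local Open Scope ring_scope.

(* Not to be confused with MathComp-Analysis's [zero_dimensional], which only
   asks that clopen sets separate points. *)
Definition zero_dimensional_space (X : topologicalType) : Prop :=
  hausdorff_space X /\
  exists B : set_system X, basis B /\ (forall U, B U -> clopen U).

(* The third clause says that [X] carries the initial topology along [e], i.e.
   [e] is a homeomorphism onto the subspace [range e]. *)
Definition topological_embedding (X Y : topologicalType) (e : X -> Y) : Prop :=
  [/\ injective e,
      continuous e &
      forall U : set X, open U ->
        exists V : set Y, open V /\ U = e @^-1` V].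

(* The Banaschewski compactification is unique up to homeomorphism, so it is
   given by a space [Y] with an embedding [e] of [X] having its defining
   properties. The two-point space {0,1} is [bool], discretely topologized. *)
Definition is_banaschewski_compactification
    (X Y : topologicalType) (e : X -> Y) : Prop :=
  [/\ compact [set: Y],
      zero_dimensional_space Y,
      topological_embedding e,
      dense (range e) &
      forall g : X -> bool, continuous g ->
        exists G : Y -> bool, continuous G /\ (forall x, G (e x) = g x)].

Section CountableImage.
Variables (R : realType) (X : topologicalType).

Definition Cc : set (X -> R) :=
  [set f | continuous f /\ countable (range f)].

Definition zero_set (f : X -> R) : set X := [set x | f x = 0].

Definition support (f : X -> R) : set X := closure (~` zero_set f).

Definition CcK : set (X -> R) := [set f | Cc f /\ compact (support f)].

Variables (Y : topologicalType) (e : X -> Y).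

(* [X] is identified with [range e], so the zero set is taken inside [Y] as the
   image [e @` zero_set f]. *)
Definition Oc_point (p : Y) : set (X -> R) :=
  [set f | Cc f /\ interior (closure (e @` zero_set f)) p].

(* Intersecting with [Cc] only matters for [A = set0]. *)
Definition Oc (A : set Y) : set (X -> R) :=
  Cc `&` \bigcap_(p in A) Oc_point p.

Lemma OcE (A : set Y) :
  Oc A = [set f | Cc f /\ A `<=` interior (closure (e @` zero_set f))].
Proof.
apply/seteqP; split=> f [Cf Hf]; split=> // p Ap; first by case: (Hf p Ap).
by split=> //; exact: Hf.
Qed.

End CountableImage.

Arguments Cc : clear implicits.
Arguments CcK : clear implicits.
Arguments Oc_point R {X Y} e p.
Arguments Oc R {X Y} e A.

(* Main.v *)
Require Import Defs.
From mathcomp Require Import all_boot all_order all_algebra.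
From mathcomp Require Import all_classical all_reals all_analysis.

Import numFieldNormedType.Exports.

Local Open Scope classical_set_scope.

(** Identify [X] with [range e] in [bX].  If the support of [f] is compact, it
    is closed in the Hausdorff space [bX]; its complement is then an open set
    that contains every point outside [X] and, by density of [X], consists of
    limits of zeros of [f] ([closure_image_setC]).  Conversely, if every point
    outside [X] is interior to the closure of the zero set, the complement of
    that interior is a closed subset of the compact [bX] lying inside [X], hence
    a compact subset of [X] ([embedding_preimage_compact]).  It contains the
    support of [f], because a nonzero of [f] has a neighbourhood without zeros,
    and this neighbourhood is the trace of an open set of [bX]
    ([embedding_closure_preimage]). *)

Lemma closed_zero_set (R : realType) (X : topologicalType) (f : X -> R) :
  continuous f -> closed (zero_set f).
Proof.
move=> cf; rewrite (_ : zero_set f = f @^-1` [set 0%R]) //.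
by apply: closed_comp => [x _|]; [exact: cf | exact: closed_eq].
Qed.

Lemma embedding_closure_preimage {X Y : topologicalType} {e : X -> Y}
    (A : set X) :
  topological_embedding e -> e @^-1` closure (e @` A) `<=` closure A.
Proof.
move=> [_ _ e_init] x clx U; rewrite nbhsE => -[W [oW Wx] WU].
have [V [oV WE]] := e_init W oW.
have Vex : V (e x) by move: Wx; rewrite WE.
have [_ [[a Aa <-] Vea]] := clx V (open_nbhs_nbhs (conj oV Vex)).
by exists a; split=> //; apply: WU; rewrite WE.
Qed.

(** A filter on [X] concentrated on the preimage of [K] clusters where its
    image does: the image has a cluster point in [K], which is some [e x], and
    the neighbourhoods of [x] are traces of those of [e x]. *)
Lemma embedding_preimage_compact {X Y : topologicalType} {e : X -> Y}
    (K : set Y) :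
  topological_embedding e ->
  compact K -> K `<=` range e -> compact (e @^-1` K).
Proof.
move=> e_emb cK Ke F FF FK.
have [y [Ky cly]] := cK (e @ F) _ FK.
have [x _ exy] := Ke y Ky; exists x; split; first by rewrite /= exy.
move=> A U FA nU.
have clA : closure (e @` A) (e x).
  rewrite exy => V nV; apply: (cly (e @` A) V) nV.
  by apply: (@filterS _ F _ A) => // a Aa; exists a.
exact: (embedding_closure_preimage _ e_emb) clA U nU.
Qed.

(** The complement of [e @` S] is open, so each neighbourhood of one of its
    points meets the dense [range e] within that complement. *)
Lemma closure_image_setC {X Y : topologicalType} {e : X -> Y} {S : set X} :
  dense (range e) -> closed (e @` S) ->
  ~` (e @` S) `<=` closure (e @` (~` S)).
Proof.
move=> de cS p Sp U; rewrite nbhsE => -[W [oW Wp] WU].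
have oWS : open (W `&` ~` (e @` S)) by apply: openI => //; exact: closed_openC.
have [q [[Wq nSq] [x _ exq]]] := de _ (ex_intro _ p (conj Wp Sp)) oWS.
exists q; split; last exact: WU.
by exists x => // Sx; apply: nSq; exists x.
Qed.

Theorem theorem2p4 (R : realType) (X : topologicalType)
    (hX : zero_dimensional_space X)
    (bX : topologicalType) (e : X -> bX)
    (hbX : is_banaschewski_compactification e) :
  CcK R X = Oc R e ([set: bX] `\` range e).
Proof.
have [cY [hY _] e_emb de _] := hbX; have [_ ce _] := e_emb.
rewrite OcE; apply/seteqP; split=> f [Cf].
  move=> cS; split=> // p [_ ep].
  have clS : closed (e @` Defs.support f).
    apply: compact_closed => //; apply: continuous_compact => //.
    exact: continuous_subspaceT.
  rewrite /interior nbhsE /=; exists (~` (e @` Defs.support f)).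
    split; first exact: closed_openC.
    by move=> [x _ exp]; apply: ep; exists x.
  apply: subset_trans (closure_image_setC de clS) _.
  apply/closure_subset/image_subset => x nSx.
  by apply: contrapT => fx; apply/nSx/subset_closure.
move=> sub; split=> //.
set K := ~` interior (closure (e @` zero_set f)).
have clK : closed K by apply: open_closedC; exact: open_interior.
have cK : compact K by exact: subclosed_compact clK cY _.
have Ke : K `<=` range e.
  by move=> y Ky; apply: contrapT => ny; apply/Ky/sub.
have suppK : Defs.support f `<=` e @^-1` K.
  have clpre : closed (e @^-1` K) by apply: closed_comp => // x _; exact: ce.
  rewrite [X in _ `<=` X](closure_id _).1 //.
  apply: closure_subset => x fx /interior_subset clx; apply: fx.
  rewrite [zero_set f](closure_id _).1; last by apply: closed_zero_set; case: Cf.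
  exact: (embedding_closure_preimage _ e_emb).
apply: subclosed_compact suppK; first exact: closed_closure.
exact: (embedding_preimage_compact _ e_emb).
Qed.
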